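(* Let $k \geq 2$. A position $(a_1,a_2,\ldots,a_k)$ of the game Max-Welter is a $\mathcal{P}$-position (under normal play) if and only if $a_k=a_{k-1}+1$ and $a_{k-1}+k$ is even.
   Context: Max-Welter is played with a finite number of coins on a semi-infinite strip of squares labeled $0,1,2,3,\ldots$ from its left end, each square containing at most one coin. A position with $k$ coins in squares $a_1<a_2<\cdots<a_k$ (nonnegative integers) is denoted $(a_1,a_2,\ldots,a_k)$. Two players move alternately; a move consists of taking the coin in the largest occupied square $a_k$ and moving it to any empty square on its left (jumping over other coins is legal). Only the rightmost coin of the current position may be moved; after a move the coins are re-indexed in increasing order. Under normal play, the player first unable to move loses. A position is an $\mathcal{N}$-position if the player about to move has a winning strategy; otherwise it is a $\mathcal{P}$-position (equivalently, its Sprague-Grundy value is $0$). *)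

(* Defs.v *)
From mathcomp Require Import all_boot.

Set Implicit Arguments.
Unset Strict Implicit.
Unset Printing Implicit Defensive.

(* The squares a_1 < ... < a_k occupied by the coins; a_i is [nth 0 a i.-1]. *)
Record position := Position {
  squares :> seq nat;
  squares_sorted : sorted ltn squares
}.

(* As the occupied squares are listed increasingly, the coin that moves is in
   square [last 0 a]; the empty position has no move, since no x < 0 exists.
   Being sorted, [b] is determined by the [perm_eq], which re-indexes the
   coins. *)
Definition move (a b : position) : Prop :=
  exists x : nat,
    [/\ x < last 0 a, x \notin (a : seq nat)
      & perm_eq b (x :: rem (last 0 a) a)].

(* [wins s a]: the player about to move at [a] and playing [s a'] at each of
   his turns [a'] always has a legal move, and after finitely many turns leaves
   the opponent without one, whatever the opponent plays. *)
Inductive wins (s : position -> position) (a : position) : Prop :=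
  Wins of move a (s a) & (forall b, move (s a) b -> wins s b).

Definition N_position (a : position) : Prop :=
  exists s : position -> position, wins s a.

Definition P_position (a : position) : Prop := ~ N_position a.

(* Main.v *)
(** Let [M] be the largest occupied square.  The condition says that [M.-1] is occupied
    and that [M + k] is odd.  A move from such a position leaves [M.-1] as the
    largest square, which has the wrong parity.  From any other position, let
    [b] be the second largest square.  If [b + k] is even, move to [b.+1].
    If it is odd, the squares below [b] are not all occupied, for otherwise
    [b = k - 2]; move to [b.-1], or, if it is occupied, to any empty square
    below [b]. *)
Require Import Defs.
From mathcomp Require Import all_boot.
From mathcomp Require Import zify.

(** Membership and the largest square replace indices, so the test survives the re-indexing of the
    coins. With two coins or more the largest square is positive, so [.-1] does not truncate. *)
Definition cold (a : position) : bool :=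
  ((last 0 a).-1 \in (a : seq nat)) && odd (last 0 a + size a).

Lemma position_uniq (a : position) : uniq a.
Proof. by have := squares_sorted a; rewrite ltn_sorted_uniq_leq => /andP[]. Qed.

Lemma last_mem (a : position) : 0 < size a -> last 0 a \in (a : seq nat).
Proof. by case: (squares a) => // x s _; apply: mem_last. Qed.

Lemma mem_le_last (a : position) y : y \in (a : seq nat) -> y <= last 0 a.
Proof.
have := squares_sorted a; case/lastP: (squares a) => // s z.
rewrite last_rcons -cats1 ltn_sorted_uniq_leq => /andP[_].
rewrite sorted_pairwise; last exact: leq_trans.
rewrite pairwise_cat => /and3P[/allrelP sz _ _].
rewrite mem_cat mem_seq1 => /orP[ys|/eqP->//].
by apply: sz; rewrite ?mem_head.
Qed.

Lemma last_eq (a : position) m :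
  m \in (a : seq nat) -> (forall y, y \in (a : seq nat) -> y <= m) ->
  last 0 a = m.
Proof.
move=> ma max_m; apply/eqP; rewrite eqn_leq mem_le_last // andbT.
by apply/max_m/last_mem; case: (squares a) ma.
Qed.

(** Trades the index of the second largest coin for its place in the order, the form used in all
    later arguments. *)
Lemma second_last (a : position) (b := nth 0 a (size a - 2)) :
  2 <= size a ->
  [/\ b \in (a : seq nat), b < last 0 a
    & forall y, y \in (a : seq nat) -> y = last 0 a \/ y <= b].
Proof.
move=> a2; have lt_nth i j : i < j -> j < size a -> nth 0 a i < nth 0 a j.
  move=> ij ja; have := sorted_ltn_nth ltn_trans 0 (squares_sorted a).
  by apply; rewrite ?inE //; apply: ltn_trans ja.
rewrite /b -nth_last; split; [|by apply: lt_nth; lia|].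
  by rewrite mem_nth // ltn_subrL /= ltnW.
move=> _ /(nthP 0)[i ia <-]; have {}ia : i < size a := ia.
have [ilt|ige] := ltnP i (size a - 2); first by right; apply/ltnW/lt_nth; lia.
have [->|ne] := eqVneq i (size a - 2); first by right.
by left; congr nth; lia.
Qed.

Lemma moveP (a b : position) :
  0 < size a -> move a b ->
  [/\ size b = size a, last 0 b < last 0 a
    & forall y, y \in (a : seq nat) -> y != last 0 a -> y \in (b : seq nat)].
Proof.
move=> a0 [x [xM xa bE]].
have sE : size b = size a.
  by rewrite (perm_size bE) /= size_rem ?last_mem // prednK.
have memb y : (y \in (b : seq nat)) =
    (y == x) || (y != last 0 a) && (y \in (a : seq nat)).
  by rewrite (perm_mem bE) inE mem_rem_uniq ?position_uniq // inE.
split=> // [|y ya yM]; last by rewrite memb yM ya orbT.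
have := @last_mem b; rewrite sE memb => /(_ a0)/orP[/eqP->//|/andP[ne la]].
by rewrite ltn_neqAle ne mem_le_last.
Qed.

Lemma cold_move (a b : position) :
  2 <= size a -> cold a -> move a b -> ~~ cold b.
Proof.
move=> a2 /andP[Ma oddM] /moveP[|sE lt_last sub]; first exact: ltnW.
have [_ bM _] := second_last a a2.
(* By [bM] the largest square is positive, so its predecessor is another square, whose coin
   stays. *)
have : (last 0 a).-1 \in (b : seq nat) by apply: sub => //; lia.
move=> /mem_le_last le_last.
by rewrite /cold negb_and sE; apply/orP; right; lia.
Qed.

(* [undup] only makes the definition total: a legal [x] is not in [a]. *)
Definition moved_seq (a : position) (x : nat) : seq nat :=
  sort leq (undup (x :: rem (last 0 a) a)).

Lemma moved_seq_sorted (a : position) (x : nat) : sorted ltn (moved_seq a x).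
Proof.
rewrite ltn_sorted_uniq_leq sort_uniq undup_uniq sort_sorted //.
exact: leq_total.
Qed.

Definition moved (a : position) (x : nat) : position :=
  Position (moved_seq_sorted a x).

Lemma move_moved (a : position) (x : nat) :
  x < last 0 a -> x \notin (a : seq nat) -> move a (moved a x).
Proof.
move=> xM xa; exists x; split=> //=.
rewrite /moved_seq undup_id ?perm_sort //= rem_uniq ?position_uniq // andbT.
by apply: contra xa => /mem_rem.
Qed.

Lemma mem_moved (a : position) (x y : nat) :
  (y \in (moved a x : seq nat)) =
  (y == x) || (y != last 0 a) && (y \in (a : seq nat)).
Proof.
by rewrite /= mem_sort mem_undup inE mem_rem_uniq ?position_uniq // inE.
Qed.

(** By counting: were all squares below [b] occupied, the coins would fill exactly [0, ..., b] and
    [last 0 a]. *)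
Lemma empty_square (a : position) (b : nat) :
  b < last 0 a -> b \in (a : seq nat) ->
  (forall y, y \in (a : seq nat) -> y = last 0 a \/ y <= b) ->
  size a != b.+2 -> exists2 x, x < b & x \notin (a : seq nat).
Proof.
move=> bM ba le_b sa.
have [/allP full|/allPn[x]] := boolP (all (mem (a : seq nat)) (iota 0 b)); last first.
  by rewrite mem_iota => xb xa; exists x.
case/eqP: sa; have a0 : 0 < size a by case: (squares a) ba.
suff /perm_size -> : perm_eq a (last 0 a :: iota 0 b.+1) by rewrite /= size_iota.
apply: uniq_perm; first exact: position_uniq.
  by rewrite cons_uniq mem_iota iota_uniq; lia.
move=> y; rewrite inE mem_iota; apply/idP/idP.
  by move=> /le_b; lia.
case/orP=> [/eqP->|yb]; first exact: last_mem.
have [->//|ne] := eqVneq y b.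
by apply: full; rewrite mem_iota; lia.
Qed.

Lemma move_to_cold (a : position) :
  2 <= size a -> ~~ cold a ->
  exists x, [/\ x < last 0 a, x \notin (a : seq nat) & cold (moved a x)].
Proof.
move=> a2; have [] := second_last a a2.
set b := nth 0 a _; move=> ba bM le_b; rewrite negb_and => hot.
(* Here [m] is the largest square after the move: [b] if the coin lands below it, [b.+1] if it lands
   just above. *)
have coldI x m : x < last 0 a -> x \notin (a : seq nat) ->
    m \in (moved a x : seq nat) -> m.-1 \in (moved a x : seq nat) ->
    x <= m -> b <= m -> odd (m + size a) -> cold (moved a x).
  move=> xM xa mm m1 xm bm oddm.
  have [|sE _ _] := @moveP a (moved a x) _ (move_moved _ _ xM xa).
    exact: ltnW.
  have lastE : last 0 (moved a x) = m.
    apply: last_eq => // y; rewrite mem_moved.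
    case/orP=> [/eqP->//|/andP[ne /le_b[yM|yb]]]; first by rewrite yM eqxx in ne.
    exact: leq_trans bm.
  by rewrite /cold lastE sE m1.
have [oddb|evenb] := boolP (odd (b + size a)).
- have [x [xb xa b1]] : exists x,
      [/\ x < b, x \notin (a : seq nat) & (b.-1 == x) || (b.-1 \in (a : seq nat))].
    have [|x xb xa] := empty_square a b bM ba le_b; first by lia.
    have [b1|b1] := boolP (b.-1 \in (a : seq nat)).
      by exists x; rewrite orbT.
    (* The empty square [x] below [b] ensures [0 < b], hence [b.-1 < b]. *)
    by exists b.-1; rewrite eqxx; split=> //; lia.
  exists x; have xM := ltn_trans xb bM; split=> //.
  apply: (coldI x b) => //; rewrite ?mem_moved ?(ltnW xb) //.
    by rewrite ba andbT; lia.
  by case/orP: b1 => ->; rewrite ?andbT; lia.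
(* Otherwise the parity of [b + size a] would make [a] cold. *)
- have bM1 : b.+1 != last 0 a.
    apply: contra evenb => /eqP bM1; move: hot.
    by rewrite -bM1 /= ba; lia.
  have xM : b.+1 < last 0 a by lia.
  have xa : b.+1 \notin (a : seq nat) by apply/negP => /le_b; lia.
  exists b.+1; split=> //; apply: (coldI b.+1 b.+1) => //.
  + by rewrite mem_moved eqxx.
  + by rewrite mem_moved /= ba andbT; lia.
Qed.

(** A strategy is a total function, so the target is found by a finite search; the fallback [a] is
    never reached from a non-cold position with two coins or more. *)
Definition cold_strategy (a : position) : position :=
  if [pick x : 'I_(last 0 a) | (val x \notin (a : seq nat)) && cold (moved a x)]
    is Some x then moved a x else a.

Lemma cold_strategyP (a : position) :
  2 <= size a -> ~~ cold a ->
  move a (cold_strategy a) /\ cold (cold_strategy a).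
Proof.
move=> a2 /(move_to_cold _ a2)[x [xM xa coldx]]; rewrite /cold_strategy.
case: pickP => [y /andP[ya coldy]|/(_ (Ordinal xM))]; last by rewrite /= xa coldx.
by split=> //; apply: move_moved.
Qed.

(** Induction on the largest square, which every move lowers. *)
Lemma hot_wins (a : position) :
  2 <= size a -> ~~ cold a -> wins cold_strategy a.
Proof.
have [n] := ubnP (last 0 a); elim: n a => [a|n IHn a lt_an a2 hot].
  by rewrite ltn0.
have [mv coldsa] := cold_strategyP _ a2 hot.
have [sE lt_last _] := moveP _ _ (ltnW a2) mv.
apply: Wins mv _ => b mvb; have sa2 : 2 <= size (cold_strategy a) by rewrite sE.
have [sbE lt_lastb _] := moveP _ _ (ltnW sa2) mvb.
apply: IHn; [by lia|by rewrite sbE|exact: cold_move mvb].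
Qed.

(** If [a] were cold, [s] would have to leave a non-cold position, and the reply by [cold_strategy]
    would bring [s] back to a cold one, against the induction hypothesis. *)
Lemma wins_hot (s : position -> position) (a : position) :
  wins s a -> 2 <= size a -> ~~ cold a.
Proof.
elim=> {}a mv _ IH a2; apply/negP => colda.
have hot := cold_move _ _ a2 colda mv.
have [sE _ _] := moveP _ _ (ltnW a2) mv.
have sa2 : 2 <= size (s a) by rewrite sE.
have [mvb coldb] := cold_strategyP _ sa2 hot.
have [sbE _ _] := moveP _ _ (ltnW sa2) mvb.
by have := IH _ mvb; rewrite coldb sbE => /(_ sa2).
Qed.

Lemma P_position_cold (a : position) :
  2 <= size a -> P_position a <-> cold a.
Proof.
move=> a2; split=> [Pa|colda [s /wins_hot/(_ a2)]]; last by rewrite colda.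
by apply: contraT => /(hot_wins _ a2) winsa; case: Pa; exists cold_strategy.
Qed.

Theorem theorem1 (k : nat) (hk : 2 <= k) (a : position) (ha : size a = k) :
  P_position a <->
  nth 0 a (k - 1) = nth 0 a (k - 2) + 1 /\ ~~ odd (nth 0 a (k - 2) + k).
Proof.
subst k; apply: (iff_trans (P_position_cold _ hk)).
have [ba bM le_b] := second_last _ hk.
rewrite subn1 nth_last /cold; split.
  (* The case [M.-1 = M] of [Mb] is excluded by [0 < M]; the other, with [bM], forces [M] to be the
     successor of the second largest square. *)
  by case/andP=> /le_b Mb oddM; have ME : last 0 a = (nth 0 a (size a - 2)).+1; lia.
by case=> ME evenb; rewrite ME addn1 ba; lia.
Qed.
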